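(* Let a natural deduction theory with classifier $p:\mathbb P\to\mathbf{ctx}$ be given, with entailment classifier $e:\mathbb E\to\mathbf{ctx}$. The relation captured by $e$ is transitive in the sense that the rule $$\frac{x;\psi\vdash\phi\qquad x;\phi\vdash\chi}{x;\psi\vdash\chi}\ (T)$$ is in the theory. That is, there is a functor $t:\mathbb E d.c\mathbb E\to\mathbb E$ belonging to the rules $\mathscr R$ of the theory that sends a pair $(\psi\to\phi,\ \phi\to\chi)$ of composable vertical arrows over $x$ to the vertical arrow $\psi\to\chi$ over $x$.
   Context: Judgemental theory: a category $\mathbf{ctx}$ with terminal object, a set $\mathscr R$ of functors (''rules''), of which those with codomain $\mathbf{ctx}$ are the ''judgements'' $\mathscr J$, and a set $\mathscr P$ of natural transformations (''policies'') filling triangles of rules, such that: $\mathscr R,\mathscr P$ are closed under composition and under finite limits (pullbacks, equalizers, finite powers $\mathcal X^n$ and arrow categories $\mathcal X^{\mathsf 2}$ with $\mathrm{dom},\mathrm{cod}$ and the tautological transformation $\mathrm{dom}\Rightarrow\mathrm{cod}$; projections and functors induced by cones of rules are again in $\mathscr R$), $\mathscr P$ is closed under whiskering with rules, and the theory is closed under $\sharp$-liftings: given rules $\lambda:\mathcal F\to\mathcal G$, $r:\mathcal F\to\mathcal X$, $r':\mathcal G\to\mathcal X$, a policy $\lambda^\sharp:r'\lambda\Rightarrow r$ and a rule $h:\mathcal H\to\mathcal X$ which is a fibration, the functor $\mathcal F\times_{\mathcal X}\mathcal H\to\mathcal G\times_{\mathcal X}\mathcal H$, $(F,H)\mapsto(\lambda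 F,H[\lambda^\sharp_F])$ is in $\mathscr R$, and the natural transformation with components the cartesian lifts $H[\lambda^\sharp_F]\to H$ is in $\mathscr P$ (and dually for opfibrations). Natural deduction theory (NDT): the judgemental theory generated by one classifier $p:\mathbb P\to\mathbf{ctx}$, where $\mathbf{ctx}$ is the category of finite sets and $p$ is a faithful fibration with fibered finite products $\wedge$, fibered implication and fibered initial objects (these operators being counted among the rules). It is required to be substitutional: judgement classifiers are fibrations, rules preserve cartesian maps, policies have cartesian components. Entailment classifier: let $I:\mathbf{ctx}\to\mathbf{ctx}^{\mathsf 2}$, $x\mapsto\mathrm{id}_x$; $\mathbb E$ is the pullback of $p^{\mathsf 2}:\mathbb P^{\mathsf 2}\to\mathbf{ctx}^{\mathsf 2}$ along $I$, i.e. the category of $p$-vertical arrows, with projection $e:\mathbb E\to\mathbf{ctx}$. Write $d,c:\mathbb E\to\mathbb P$ for domain and codomain. The judgement $x;\psi\vdash\phi$ means that there is an object $\psi\to\phi$ of $\mathbb E$ over $x$. $\mathbb E d.c\mathbb E$ is the pullback of $c:\mathbb E\to\mathbb P$ along $d:\mathbb E\to\mathbb P$, i.e. the category of composable pairs of vertical arrows. *)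

(* Defs.v *)
From Stdlib Require Import FunctionalExtensionality ProofIrrelevance.
From mathcomp Require Import all_boot.

Set Implicit Arguments.
Unset Strict Implicit.
Unset Printing Implicit Defensive.

Record category := Category {
  ob :> Type;
  hom : ob -> ob -> Type;
  idm : forall a, hom a a;
  comp : forall a b c, hom b c -> hom a b -> hom a c;
  comp1m : forall a b (f : hom a b), comp (idm b) f = f;
  compm1 : forall a b (f : hom a b), comp f (idm a) = f;
  compA : forall a b c d (h : hom c d) (g : hom b c) (f : hom a b),
    comp h (comp g f) = comp (comp h g) f }.

Arguments idm {_} a.
Arguments comp {_ _ _ _} g f.

Reserved Notation "g ∘ f" (at level 40, left associativity).
Notation "g ∘ f" := (comp g f).

(** An arrow packed with its endpoints: [Arr f = Arr g] says that [f] and [g]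
    are the same arrow even when their endpoints are only provably equal. *)
Record arr (C : category) := MkArr { src : C; tgt : C; mor : hom src tgt }.
Definition Arr (C : category) (a b : C) (f : hom a b) : arr C := MkArr f.

Record functor (C D : category) := Functor {
  fob :> C -> D;
  fmap : forall a b, hom a b -> hom (fob a) (fob b);
  fmap_id : forall a, fmap (idm a) = idm (fob a);
  fmap_comp : forall a b c (g : hom b c) (f : hom a b),
    fmap (g ∘ f) = fmap g ∘ fmap f }.

Arguments fmap {_ _} _ {_ _} _.

Definition fid (C : category) : functor C C :=
  @Functor C C (fun a => a) (fun _ _ f => f) (fun _ => erefl)
    (fun _ _ _ _ _ => erefl).

Lemma fcomp_id_subproof C D E (G : functor D E) (F : functor C D) a :
  fmap G (fmap F (idm a)) = idm (G (F a)).
Proof. by rewrite !fmap_id. Qed.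

Lemma fcomp_comp_subproof C D E (G : functor D E) (F : functor C D)
    a b c (g : hom b c) (f : hom a b) :
  fmap G (fmap F (g ∘ f)) = fmap G (fmap F g) ∘ fmap G (fmap F f).
Proof. by rewrite !fmap_comp. Qed.

Definition fcomp C D E (G : functor D E) (F : functor C D) : functor C E :=
  @Functor C E (fun a => G (F a)) (fun _ _ f => fmap G (fmap F f))
    (fcomp_id_subproof G F) (fcomp_comp_subproof G F).

Reserved Notation "G ⊙ F" (at level 40, left associativity).
Notation "G ⊙ F" := (fcomp G F).

Record nat_trans (C D : category) (F G : functor C D) := NatTrans {
  ncomp :> forall a, hom (F a) (G a);
  ncomp_nat : forall a b (f : hom a b), ncomp b ∘ fmap F f = fmap G f ∘ ncomp a }.

Lemma nat_id_subproof C D (F : functor C D) a b (f : hom a b) :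
  idm (F b) ∘ fmap F f = fmap F f ∘ idm (F a).
Proof. by rewrite comp1m compm1. Qed.

Definition nat_id C D (F : functor C D) : nat_trans F F :=
  NatTrans (ncomp := fun a => idm (F a)) (@nat_id_subproof C D F).

Lemma nat_comp_subproof C D (F G H : functor C D) (t : nat_trans G H)
    (s : nat_trans F G) a b (f : hom a b) :
  (t b ∘ s b) ∘ fmap F f = fmap H f ∘ (t a ∘ s a).
Proof. by rewrite -compA ncomp_nat compA ncomp_nat compA. Qed.

Definition nat_comp C D (F G H : functor C D) (t : nat_trans G H)
    (s : nat_trans F G) : nat_trans F H :=
  NatTrans (ncomp := fun a => t a ∘ s a) (nat_comp_subproof t s).

Lemma whisker_l_subproof C D E (K : functor D E) (F G : functor C D)
    (s : nat_trans F G) a b (f : hom a b) :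
  fmap K (s b) ∘ fmap (K ⊙ F) f = fmap (K ⊙ G) f ∘ fmap K (s a).
Proof. by rewrite /= -!fmap_comp ncomp_nat. Qed.

Definition whisker_l C D E (K : functor D E) (F G : functor C D)
    (s : nat_trans F G) : nat_trans (K ⊙ F) (K ⊙ G) :=
  @NatTrans C E (K ⊙ F) (K ⊙ G) (fun a => fmap K (s a))
    (whisker_l_subproof K s).

Lemma whisker_r_subproof C D E (F G : functor D E) (s : nat_trans F G)
    (K : functor C D) a b (f : hom a b) :
  s (K b) ∘ fmap (F ⊙ K) f = fmap (G ⊙ K) f ∘ s (K a).
Proof. by rewrite /= ncomp_nat. Qed.

Definition whisker_r C D E (F G : functor D E) (s : nat_trans F G)
    (K : functor C D) : nat_trans (F ⊙ K) (G ⊙ K) :=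
  @NatTrans C E (F ⊙ K) (G ⊙ K) (fun a => s (K a)) (whisker_r_subproof s K).

Definition is_terminal (C : category) (t : C) : Prop :=
  forall a : C, exists! f : hom a t, True.

Definition FinSet : category :=
  @Category finType (fun T U => T -> U) (fun _ x => x)
    (fun _ _ _ g f x => g (f x)) (fun _ _ _ => erefl) (fun _ _ _ => erefl)
    (fun _ _ _ _ _ _ _ => erefl).

Lemma FinSet_terminal : is_terminal (unit : FinSet).
Proof.
move=> a; exists (fun _ => tt); split=> // g _.
by apply: functional_extensionality => x; case: (g x).
Qed.

Section ArrLemmas.
Variables C D : category.

Lemma Arr_inj (a b : C) (f g : hom a b) : Arr f = Arr g -> f = g.
Proof.
move=> E; have E1 := f_equal (fun x : arr C => existT (fun ab => hom ab.1 ab.2)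
                                       (src x, tgt x) (mor x)) E.
exact: (ProofIrrelevanceTheory.EqdepTheory.inj_pair2 _ _ _ _ _ E1).
Qed.

Lemma Arr_idm (a b : C) : a = b -> Arr (idm a) = Arr (idm b).
Proof. by move=> ->. Qed.

Lemma Arr_src (a b a' b' : C) (f : hom a b) (g : hom a' b') :
  Arr f = Arr g -> a = a'.
Proof. exact: (f_equal (@src C)). Qed.

Lemma Arr_tgt (a b a' b' : C) (f : hom a b) (g : hom a' b') :
  Arr f = Arr g -> b = b'.
Proof. exact: (f_equal (@tgt C)). Qed.

Lemma Arr_comp (a b c a' b' c' : C) (g : hom b c) (f : hom a b)
    (g' : hom b' c') (f' : hom a' b') :
  Arr g = Arr g' -> Arr f = Arr f' -> Arr (g ∘ f) = Arr (g' ∘ f').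
Proof.
move=> Eg Ef.
move: (Arr_src Ef) (Arr_tgt Ef) (Arr_tgt Eg) => E1 E2 E3.
destruct E1, E2, E3.
by rewrite (Arr_inj Eg) (Arr_inj Ef).
Qed.

Lemma Arr_fmap (F : functor C D) (a b a' b' : C) (f : hom a b)
    (g : hom a' b') : Arr f = Arr g -> Arr (fmap F f) = Arr (fmap F g).
Proof.
move=> E; move: (Arr_src E) (Arr_tgt E) => E1 E2.
by destruct E1, E2; rewrite (Arr_inj E).
Qed.

Lemma Arr_cast (a b a' b' : C) (f : hom a b) : a = a' -> b = b' ->
  exists f' : hom a' b', Arr f' = Arr f.
Proof. by move=> <- <-; exists f. Qed.

End ArrLemmas.

Lemma sig_ext (T : Type) (P : T -> Prop) (u v : sig P) :
  proj1_sig u = proj1_sig v -> u = v.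
Proof. by apply: eq_sig_hprop => x; apply: proof_irrelevance. Qed.

Section Pullback.
Variables (A B C : category) (f : functor A C) (g : functor B C).

Record pb_ob := PbOb { pb_l : A; pb_r : B; pb_eq : f pb_l = g pb_r }.

Definition pb_hom (v w : pb_ob) : Type :=
  { m : hom (pb_l v) (pb_l w) * hom (pb_r v) (pb_r w)
      | Arr (fmap f m.1) = Arr (fmap g m.2) }.

Definition PbHom (v w : pb_ob) (m : hom (pb_l v) (pb_l w))
    (n : hom (pb_r v) (pb_r w)) (E : Arr (fmap f m) = Arr (fmap g n)) :
  pb_hom v w := exist _ (m, n) E.

Lemma pb_idm_subproof v :
  Arr (fmap f (idm (pb_l v))) = Arr (fmap g (idm (pb_r v))).
Proof. by rewrite !fmap_id; apply: Arr_idm; apply: pb_eq. Qed.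

Definition pb_idm v : pb_hom v v := PbHom (pb_idm_subproof v).

Lemma pb_comp_subproof u v w (m : pb_hom v w) (n : pb_hom u v) :
  Arr (fmap f ((proj1_sig m).1 ∘ (proj1_sig n).1))
  = Arr (fmap g ((proj1_sig m).2 ∘ (proj1_sig n).2)).
Proof.
by rewrite !fmap_comp; apply: Arr_comp; [apply: (proj2_sig m)|apply: (proj2_sig n)].
Qed.

Definition pb_comp u v w (m : pb_hom v w) (n : pb_hom u v) : pb_hom u w :=
  PbHom (pb_comp_subproof m n).

Definition pullback : category.
Proof.
refine (@Category pb_ob pb_hom pb_idm pb_comp _ _ _).
- by move=> a b [[m n] E]; apply: sig_ext; rewrite /= !comp1m.
- by move=> a b [[m n] E]; apply: sig_ext; rewrite /= !compm1.
- by move=> a b c d h k l; apply: sig_ext; rewrite /= !compA.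
Defined.

Definition pb1 : functor pullback A :=
  @Functor pullback A pb_l (fun _ _ m => (proj1_sig m).1) (fun _ => erefl)
    (fun _ _ _ _ _ => erefl).
Definition pb2 : functor pullback B :=
  @Functor pullback B pb_r (fun _ _ m => (proj1_sig m).2) (fun _ => erefl)
    (fun _ _ _ _ _ => erefl).

End Pullback.

Arguments pb1 {_ _ _} f g.
Arguments pb2 {_ _ _} f g.

Section Equalizer.
Variables (A B : category) (f g : functor A B).

Definition eqz_ob : Type := { a : A | f a = g a }.
Definition eqz_hom (v w : eqz_ob) : Type :=
  { m : hom (proj1_sig v) (proj1_sig w) | Arr (fmap f m) = Arr (fmap g m) }.

Lemma eqz_idm_subproof (v : eqz_ob) :
  Arr (fmap f (idm (proj1_sig v))) = Arr (fmap g (idm (proj1_sig v))).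
Proof. by rewrite !fmap_id; apply: Arr_idm; apply: (proj2_sig v). Qed.

Definition eqz_idm v : eqz_hom v v := exist _ _ (eqz_idm_subproof v).

Lemma eqz_comp_subproof u v w (m : eqz_hom v w) (n : eqz_hom u v) :
  Arr (fmap f (proj1_sig m ∘ proj1_sig n))
  = Arr (fmap g (proj1_sig m ∘ proj1_sig n)).
Proof.
by rewrite !fmap_comp; apply: Arr_comp; [apply: (proj2_sig m)|apply: (proj2_sig n)].
Qed.

Definition eqz_comp u v w (m : eqz_hom v w) (n : eqz_hom u v) : eqz_hom u w :=
  exist _ _ (eqz_comp_subproof m n).

Definition equalizer : category.
Proof.
refine (@Category eqz_ob eqz_hom eqz_idm eqz_comp _ _ _).
- by move=> a b m; apply: sig_ext; rewrite /= comp1m.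
- by move=> a b m; apply: sig_ext; rewrite /= compm1.
- by move=> a b c d h k l; apply: sig_ext; rewrite /= compA.
Defined.

Definition eqz_incl : functor equalizer A :=
  @Functor equalizer A (@proj1_sig _ _) (fun _ _ m => proj1_sig m)
    (fun _ => erefl) (fun _ _ _ _ _ => erefl).

End Equalizer.

Section Power.
Variables (n : nat) (X : category).

Definition power : category.
Proof.
refine (@Category ('I_n -> X) (fun v w => forall i, hom (v i) (w i))
          (fun v i => idm (v i)) (fun _ _ _ m k i => m i ∘ k i) _ _ _).
- by move=> a b m; apply: functional_extensionality_dep => i; rewrite comp1m.
- by move=> a b m; apply: functional_extensionality_dep => i; rewrite compm1.
- by move=> a b c d h k l; apply: functional_extensionality_dep => i; rewrite compA.
Defined.

Definition power_proj (i : 'I_n) : functor power X :=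
  @Functor power X (fun v => v i) (fun _ _ m => m i) (fun _ => erefl)
    (fun _ _ _ _ _ => erefl).

End Power.

Section ArrowCategory.
Variable X : category.

Definition sq_hom (v w : arr X) : Type :=
  { m : hom (src v) (src w) * hom (tgt v) (tgt w)
      | mor w ∘ m.1 = m.2 ∘ mor v }.

Lemma sq_idm_subproof (v : arr X) : mor v ∘ idm (src v) = idm (tgt v) ∘ mor v.
Proof. by rewrite comp1m compm1. Qed.

Definition sq_idm v : sq_hom v v := exist _ (_, _) (sq_idm_subproof v).

Lemma sq_comp_subproof (u v w : arr X) (m : sq_hom v w) (n : sq_hom u v) :
  mor w ∘ ((proj1_sig m).1 ∘ (proj1_sig n).1)
  = ((proj1_sig m).2 ∘ (proj1_sig n).2) ∘ mor u.
Proof. by rewrite compA (proj2_sig m) -compA (proj2_sig n) compA. Qed.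

Definition sq_comp u v w (m : sq_hom v w) (n : sq_hom u v) : sq_hom u w :=
  exist _ (_, _) (sq_comp_subproof m n).

Definition arrow_cat : category.
Proof.
refine (@Category (arr X) sq_hom sq_idm sq_comp _ _ _).
- by move=> a b [[m n] E]; apply: sig_ext; rewrite /= !comp1m.
- by move=> a b [[m n] E]; apply: sig_ext; rewrite /= !compm1.
- by move=> a b c d h k l; apply: sig_ext; rewrite /= !compA.
Defined.

Definition fdom : functor arrow_cat X :=
  @Functor arrow_cat X (@src X) (fun _ _ m => (proj1_sig m).1) (fun _ => erefl)
    (fun _ _ _ _ _ => erefl).
Definition fcod : functor arrow_cat X :=
  @Functor arrow_cat X (@tgt X) (fun _ _ m => (proj1_sig m).2) (fun _ => erefl)
    (fun _ _ _ _ _ => erefl).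

Definition tautological : nat_trans fdom fcod :=
  @NatTrans arrow_cat X fdom fcod (@mor X) (fun _ _ m => proj2_sig m).

Lemma id_arrow_subproof (a b : X) (f : hom a b) : idm b ∘ f = f ∘ idm a.
Proof. by rewrite comp1m compm1. Qed.

Definition id_arrow : functor X arrow_cat.
Proof.
refine (@Functor X arrow_cat (fun a => Arr (idm a))
  (fun a b f => exist _ (f, f) (id_arrow_subproof f)) _ _).
- by move=> a; apply: sig_ext.
- by move=> a b c g f; apply: sig_ext.
Defined.

End ArrowCategory.

Lemma arrow_fun_subproof X Y (F : functor X Y) (v w : arr X) (m : sq_hom v w) :
  fmap F (mor w) ∘ fmap F (proj1_sig m).1
  = fmap F (proj1_sig m).2 ∘ fmap F (mor v).
Proof. by rewrite -!fmap_comp (proj2_sig m). Qed.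

Definition arrow_fun X Y (F : functor X Y) :
  functor (arrow_cat X) (arrow_cat Y).
Proof.
refine (@Functor (arrow_cat X) (arrow_cat Y)
  (fun v => Arr (fmap F (mor v)))
  (fun v w m => exist _ (fmap F (proj1_sig m).1, fmap F (proj1_sig m).2)
                  (arrow_fun_subproof F m)) _ _).
- by move=> a; apply: sig_ext; rewrite /= !fmap_id.
- by move=> a b c g f; apply: sig_ext; rewrite /= !fmap_comp.
Defined.

Definition vertical E B (p : functor E B) (a b : E) (f : hom a b) : Prop :=
  Arr (fmap p f) = Arr (idm (p a)).

Definition faithful E B (p : functor E B) : Prop :=
  forall (a b : E) (f g : hom a b), fmap p f = fmap p g -> f = g.

Definition cartesian E B (p : functor E B) (a b : E) (f : hom a b) : Prop :=
  forall (c : E) (g : hom c b) (w : hom (p c) (p a)), fmap p f ∘ w = fmap p g ->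
    exists! v : hom c a, fmap p v = w /\ f ∘ v = g.

Definition opcartesian E B (p : functor E B) (a b : E) (f : hom a b) : Prop :=
  forall (c : E) (g : hom a c) (w : hom (p b) (p c)), w ∘ fmap p f = fmap p g ->
    exists! v : hom b c, fmap p v = w /\ v ∘ f = g.

Definition fibration E B (p : functor E B) : Prop :=
  forall (b : E) (x : B) (u : hom x (p b)),
    exists (a : E) (f : hom a b), cartesian p f /\ Arr (fmap p f) = Arr u.

Definition opfibration E B (p : functor E B) : Prop :=
  forall (a : E) (x : B) (u : hom (p a) x),
    exists (b : E) (f : hom a b), opcartesian p f /\ Arr (fmap p f) = Arr u.

Definition preserves_cartesian E E' B (p : functor E B) (p' : functor E' B)
    (F : functor E E') : Prop :=
  forall (a b : E) (f : hom a b), cartesian p f -> cartesian p' (fmap F f).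

(** A policy filling a triangle of rules [λ : F → G], [r : F → X],
    [r' : G → X] is a natural transformation between the parallel functors
    [r' ⊙ λ] and [r]; its sides are rules by the clauses [jt_policy_dom],
    [jt_policy_cod] and [jt_comp] below. *)
Record pretheory := Pretheory {
  rule : forall C D : category, functor C D -> Prop;
  policy : forall (C D : category) (F G : functor C D), nat_trans F G -> Prop }.

Definition judgement (ctx : category) (T : pretheory) (C : category)
  (j : functor C ctx) : Prop := rule T j.

(** A category [C] belongs to the theory [T] when [rule T (fid C)] holds.
    In each closure clause under a limit, the limit is the strict one built
    above, and a functor (or natural transformation) into it is the one induced
    by the cone of its composites (or whiskerings) with the projections. *)
Record is_judgemental (ctx : category) (T : pretheory) : Prop := IsJudgemental {
  jt_terminal : exists t : ctx, is_terminal t;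
  jt_ctx : rule T (fid ctx);

  jt_rule_dom : forall C D (F : functor C D), rule T F -> rule T (fid C);
  jt_rule_cod : forall C D (F : functor C D), rule T F -> rule T (fid D);
  jt_comp : forall C D E (G : functor D E) (F : functor C D),
    rule T G -> rule T F -> rule T (G ⊙ F);

  jt_policy_dom : forall C D (F G : functor C D) (s : nat_trans F G),
    policy T s -> rule T F;
  jt_policy_cod : forall C D (F G : functor C D) (s : nat_trans F G),
    policy T s -> rule T G;
  jt_nat_id : forall C D (F : functor C D), rule T F -> policy T (nat_id F);
  jt_nat_comp : forall C D (F G H : functor C D)
      (t : nat_trans G H) (s : nat_trans F G),
    policy T t -> policy T s -> policy T (nat_comp t s);
  jt_whisker_l : forall C D E (K : functor D E) (F G : functor C D)
      (s : nat_trans F G),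
    rule T K -> policy T s -> policy T (whisker_l K s);
  jt_whisker_r : forall C D E (F G : functor D E) (s : nat_trans F G)
      (K : functor C D),
    policy T s -> rule T K -> policy T (whisker_r s K);

  jt_pb1 : forall A B C (f : functor A C) (g : functor B C),
    rule T f -> rule T g -> rule T (pb1 f g);
  jt_pb2 : forall A B C (f : functor A C) (g : functor B C),
    rule T f -> rule T g -> rule T (pb2 f g);
  jt_pb_cone : forall A B C (f : functor A C) (g : functor B C) Y
      (h : functor Y (pullback f g)),
    rule T f -> rule T g ->
    rule T (pb1 f g ⊙ h) -> rule T (pb2 f g ⊙ h) -> rule T h;
  jt_pb_cone2 : forall A B C (f : functor A C) (g : functor B C) Y
      (h k : functor Y (pullback f g)) (s : nat_trans h k),
    rule T f -> rule T g -> policy T (whisker_l (pb1 f g) s) ->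
    policy T (whisker_l (pb2 f g) s) -> policy T s;

  jt_eqz : forall A B (f g : functor A B),
    rule T f -> rule T g -> rule T (eqz_incl f g);
  jt_eqz_cone : forall A B (f g : functor A B) Y (h : functor Y (equalizer f g)),
    rule T f -> rule T g -> rule T (eqz_incl f g ⊙ h) -> rule T h;
  jt_eqz_cone2 : forall A B (f g : functor A B) Y
      (h k : functor Y (equalizer f g)) (s : nat_trans h k),
    rule T f -> rule T g -> policy T (whisker_l (eqz_incl f g) s) -> policy T s;

  jt_power : forall n X, rule T (fid X) -> rule T (fid (power n X));
  jt_power_proj : forall n X (i : 'I_n),
    rule T (fid X) -> rule T (power_proj X i);
  jt_power_cone : forall n X Y (h : functor Y (power n X)),
    rule T (fid X) -> rule T (fid Y) ->
    (forall i, rule T (power_proj X i ⊙ h)) -> rule T h;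
  jt_power_cone2 : forall n X Y (h k : functor Y (power n X))
      (s : nat_trans h k),
    rule T (fid X) -> rule T (fid Y) ->
    (forall i, policy T (whisker_l (power_proj X i) s)) -> policy T s;

  jt_dom : forall X, rule T (fid X) -> rule T (fdom X);
  jt_cod : forall X, rule T (fid X) -> rule T (fcod X);
  jt_tautological : forall X, rule T (fid X) -> policy T (tautological X);
  jt_arrow_cone : forall X Y (h : functor Y (arrow_cat X)),
    rule T (fid X) -> rule T (fdom X ⊙ h) -> rule T (fcod X ⊙ h) ->
    policy T (whisker_r (tautological X) h) -> rule T h;
  jt_arrow_cone2 : forall X Y (h k : functor Y (arrow_cat X))
      (s : nat_trans h k),
    rule T h -> rule T k -> policy T (whisker_l (fdom X) s) ->
    policy T (whisker_l (fcod X) s) -> policy T s;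

  (* [lift] and [cleav] range over all choices of lifts of the components of
     [sharp], so the closure does not depend on a cleavage. *)
  jt_sharp : forall F G X H (lam : functor F G) (r : functor F X)
      (r' : functor G X) (sharp : nat_trans (r' ⊙ lam) r) (h : functor H X)
      (lift : functor (pullback r h) (pullback r' h))
      (cleav : nat_trans (pb2 r' h ⊙ lift) (pb2 r h)),
    rule T lam -> rule T r -> rule T r' -> policy T sharp ->
    rule T h -> fibration h ->
    pb1 r' h ⊙ lift = lam ⊙ pb1 r h ->
    (forall w, cartesian h (cleav w) /\
       Arr (fmap h (cleav w)) = Arr (sharp (pb1 r h w))) ->
    rule T lift /\ policy T cleav;
  jt_flat : forall F G X H (lam : functor F G) (r : functor F X)
      (r' : functor G X) (flat : nat_trans r (r' ⊙ lam)) (h : functor H X)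
      (lift : functor (pullback r h) (pullback r' h))
      (cleav : nat_trans (pb2 r h) (pb2 r' h ⊙ lift)),
    rule T lam -> rule T r -> rule T r' -> policy T flat ->
    rule T h -> opfibration h ->
    pb1 r' h ⊙ lift = lam ⊙ pb1 r h ->
    (forall w, opcartesian h (cleav w) /\
       Arr (fmap h (cleav w)) = Arr (flat (pb1 r h w))) ->
    rule T lift /\ policy T cleav }.

Record judgemental_theory (ctx : category) := JudgementalTheory {
  jt_pretheory :> pretheory;
  jt_judgemental : is_judgemental ctx jt_pretheory }.

Record sub_pretheory (S T : pretheory) : Prop := SubPretheory {
  sub_rule : forall C D (F : functor C D), rule S F -> rule T F;
  sub_policy : forall C D (F G : functor C D) (s : nat_trans F G),
    policy S s -> policy T s }.

Definition generated_pretheory (ctx : category) (G : pretheory) : pretheory :=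
  Pretheory
    (fun C D F => forall T, is_judgemental ctx T -> sub_pretheory G T ->
       @rule T C D F)
    (fun C D F F' s => forall T, is_judgemental ctx T -> sub_pretheory G T ->
       @policy T C D F F' s).

Lemma generated_judgemental (ctx : category) (G : pretheory) :
  (exists t : ctx, is_terminal t) ->
  is_judgemental ctx (generated_pretheory ctx G).
Proof.
move=> Ht; split=> //=.
all: intros.
- by eapply jt_ctx; eauto.
- by eapply jt_rule_dom; eauto.
- by eapply jt_rule_cod; eauto.
- by eapply jt_comp; eauto.
- by eapply jt_policy_dom; eauto.
- by eapply jt_policy_cod; eauto.
- by eapply jt_nat_id; eauto.
- by eapply jt_nat_comp; eauto.
- by eapply jt_whisker_l; eauto.
- by eapply jt_whisker_r; eauto.
- by eapply jt_pb1; eauto.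
- by eapply jt_pb2; eauto.
- by eapply jt_pb_cone; eauto.
- by eapply jt_pb_cone2; eauto.
- by eapply jt_eqz; eauto.
- by eapply jt_eqz_cone; eauto.
- by eapply jt_eqz_cone2; eauto.
- by eapply jt_power; eauto.
- by eapply jt_power_proj; eauto.
- by eapply jt_power_cone; eauto.
- by eapply jt_power_cone2; eauto.
- by eapply jt_dom; eauto.
- by eapply jt_cod; eauto.
- by eapply jt_tautological; eauto.
- by eapply jt_arrow_cone; eauto.
- by eapply jt_arrow_cone2; eauto.
- by split=> T HT HG; eapply (jt_sharp HT); eauto.
- by split=> T HT HG; eapply (jt_flat HT); eauto.
Qed.

Definition generated (ctx : category) (Ht : exists t : ctx, is_terminal t)
    (G : pretheory) : judgemental_theory ctx :=
  JudgementalTheory (generated_judgemental G Ht).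

Record substitutional (ctx : category) (G : pretheory) : Prop := Substitutional {
  subst_judgement : forall C (j : functor C ctx),
    judgement G j -> fibration j;
  subst_rule : forall C D (F : functor C D) (j : functor D ctx),
    rule G F -> judgement G j -> preserves_cartesian (j ⊙ F) j F;
  subst_policy : forall C D (F F' : functor C D) (s : nat_trans F F')
      (j : functor D ctx),
    policy G s -> judgement G j -> forall c, cartesian j (s c) }.

(** An arrow [a → b] over [u] in the fibrewise opposite is a span of a vertical
    arrow [c → a] and a cartesian arrow [c → b] over [u], up to isomorphism of
    [c].  For [p] faithful there is at most one class of spans over each [u],
    so the arrow is recorded by [u]. *)
Section FibrewiseOpposite.
Variables (E B : category) (p : functor E B) (Hp : fibration p).

Definition vop_hom (a b : E) : Type :=
  { u : hom (p a) (p b) |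
    exists (c : E) (v : hom c a) (k : hom c b),
      [/\ vertical p v, cartesian p k & Arr (fmap p k) = Arr u] }.

Lemma cartesian_idm (a : E) : cartesian p (idm a).
Proof.
move=> c g w; rewrite fmap_id comp1m => ->; exists g.
by split=> [|v [_]]; rewrite comp1m.
Qed.

Lemma cartesian_comp (a b c : E) (g : hom b c) (f : hom a b) :
  cartesian p g -> cartesian p f -> cartesian p (g ∘ f).
Proof.
move=> Kg Kf d h w; rewrite fmap_comp -compA => Ew.
have [x [[Ex1 Ex2] Ux]] := Kg _ _ _ Ew.
have [y [[Ey1 Ey2] Uy]] := Kf _ x w (esym Ex1).
exists y; split=> [|y' [Ey1' Ey2']]; first by rewrite -compA Ey2.
apply: Uy; split=> //; apply/esym/Ux; split; last by rewrite compA.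
by rewrite fmap_comp Ey1'.
Qed.

Lemma vop_idm_subproof (a : E) :
  exists (c : E) (v : hom c a) (k : hom c a),
    [/\ vertical p v, cartesian p k & Arr (fmap p k) = Arr (idm (p a))].
Proof.
exists a, (idm a), (idm a); rewrite /vertical !fmap_id.
by split=> //; apply: cartesian_idm.
Qed.

Definition vop_idm (a : E) : vop_hom a a := exist _ _ (vop_idm_subproof a).

Lemma vop_comp_subproof (a b c : E) (m : vop_hom b c) (n : vop_hom a b) :
  exists (d : E) (v : hom d a) (k : hom d c),
    [/\ vertical p v, cartesian p k
      & Arr (fmap p k) = Arr (proj1_sig m ∘ proj1_sig n)].
Proof.
case: m n => [u2 [d2 [v2 [k2 [V2 K2 U2]]]]] [u1 [d1 [v1 [k1 [V1 K1 U1]]]]] /=.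
have E2 : p d2 = p b := Arr_tgt (esym V2).
have E1 : p d1 = p a := Arr_tgt (esym V1).
have [u' Eu'] := Arr_cast u1 erefl (esym E2).
have [e [f [Kf Ef]]] := Hp u'.
have Ea : p e = p a := Arr_src Ef.
have [w Ew] := Arr_cast (idm (p a)) (esym Ea) (esym E1).
have Ek : fmap p k1 ∘ w = fmap p (v2 ∘ f).
  apply: Arr_inj; rewrite fmap_comp.
  by rewrite (Arr_comp U1 Ew) compm1 (Arr_comp V2 Ef) comp1m.
have [v [[Ev _] _]] := K1 _ _ _ Ek.
have Vv : Arr (fmap p v) = Arr (idm (p e)).
  by rewrite Ev Ew; apply: Arr_idm.
exists e, (v1 ∘ v), (k2 ∘ f); split.
- by rewrite /vertical fmap_comp (Arr_comp V1 (erefl (Arr (fmap p v)))) comp1m.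
- exact: cartesian_comp.
- by rewrite fmap_comp; apply: Arr_comp => //; apply: etrans Ef Eu'.
Qed.

Definition vop_comp (a b c : E) (m : vop_hom b c) (n : vop_hom a b) :
  vop_hom a c := exist _ _ (vop_comp_subproof m n).

Definition vop : category.
Proof.
refine (@Category E vop_hom vop_idm vop_comp _ _ _).
- by move=> a b m; apply: sig_ext; rewrite /= comp1m.
- by move=> a b m; apply: sig_ext; rewrite /= compm1.
- by move=> a b c d h k l; apply: sig_ext; rewrite /= compA.
Defined.

Definition vop_proj : functor vop B :=
  @Functor vop B (fun a => p a) (fun _ _ m => proj1_sig m) (fun _ => erefl)
    (fun _ _ _ _ _ => erefl).

End FibrewiseOpposite.

Section FibredOperators.
Variables (E B : category) (p : functor E B).

Definition fibre_terminal (t : E) : Prop :=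
  forall c : E, p c = p t -> exists! h : hom c t, vertical p h.

Definition fibre_initial (i : E) : Prop :=
  forall c : E, p c = p i -> exists! h : hom i c, vertical p h.

Definition fibre_product (a b w : E) : Prop :=
  exists (pa : hom w a) (pb : hom w b), [/\ vertical p pa, vertical p pb &
    forall (c : E) (f : hom c a) (g : hom c b), vertical p f -> vertical p g ->
      exists! h : hom c w, [/\ vertical p h, pa ∘ h = f & pb ∘ h = g]].

Definition fibre_exponential (conj : functor (pullback p p) E) (a b e : E) :
    Prop :=
  exists (Ee : p e = p a) (ev : hom (conj (PbOb Ee)) b), vertical p ev /\
    forall (c : E) (Ec : p c = p a) (f : hom (conj (PbOb Ec)) b),
      vertical p f ->
      exists! g : hom c e,
        exists Eg : Arr (fmap p g) = Arr (fmap p (idm a)),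
          ev ∘ fmap conj (PbHom (v := PbOb Ec) (w := PbOb Ee) Eg) = f.

End FibredOperators.

Record ndt_data := NDTData {
  prp : category;
  clf : functor prp FinSet;
  clf_faithful : faithful clf;
  clf_fibration : fibration clf;
  top : functor FinSet prp;
  top_over : clf ⊙ top = fid FinSet;
  top_terminal : forall x, fibre_terminal clf (top x);
  conj : functor (pullback clf clf) prp;
  conj_over : clf ⊙ conj = clf ⊙ pb1 clf clf;
  conj_product : forall w : pullback clf clf,
    fibre_product clf (pb_l w) (pb_r w) (conj w);
  imp : functor (pullback (vop_proj clf_fibration) clf) prp;
  imp_over : clf ⊙ imp = vop_proj clf_fibration ⊙ pb1 _ _;
  imp_exponential : forall w : pullback (vop_proj clf_fibration) clf,
    fibre_exponential conj (pb_l w) (pb_r w) (imp w);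
  bot : functor FinSet prp;
  bot_over : clf ⊙ bot = fid FinSet;
  bot_initial : forall x, fibre_initial clf (bot x) }.

Inductive ndt_generator (N : ndt_data) :
    forall C D : category, functor C D -> Prop :=
  | gen_clf : ndt_generator N (clf N)
  | gen_top : ndt_generator N (top N)
  | gen_conj : ndt_generator N (conj N)
  | gen_imp : ndt_generator N (imp N)
  | gen_bot : ndt_generator N (bot N).

Definition ndt_generators (N : ndt_data) : pretheory :=
  Pretheory (@ndt_generator N) (fun _ _ _ _ _ => False).

(** Substitutionality is required of the generating data.  The operators lie
    over the base, so for them it says that they are fibred functors, i.e.
    stable under substitution.  It cannot be required of every member of the
    generated theory: closure under equalizers and arrow categories produces
    the judgement sending an endomorphism in [FinSet] to its carrier, which is
    not a fibration, and tautological policies whose components are arbitrary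
    arrows, cartesian or not. *)
Record NDT := MkNDT {
  ndt_carrier :> ndt_data;
  ndt_substitutional : substitutional FinSet (ndt_generators ndt_carrier) }.

Definition ndt_theory (N : NDT) : judgemental_theory FinSet :=
  generated (ex_intro _ _ FinSet_terminal) (ndt_generators N).

Section Entailment.
Variable N : NDT.

Definition entail : category :=
  pullback (id_arrow FinSet) (arrow_fun (clf N)).

Definition entail_proj : functor entail FinSet := pb1 _ _.

Definition entail_arrow : functor entail (arrow_cat (prp N)) := pb2 _ _.

Definition entail_dom : functor entail (prp N) := fdom _ ⊙ entail_arrow.

Definition entail_cod : functor entail (prp N) := fcod _ ⊙ entail_arrow.

(** The two projections send a composable pair [ψ → φ], [φ → χ] to its first
    and second member respectively. *)
Definition entail_pairs : category := pullback entail_cod entail_dom.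

Definition pair_fst : functor entail_pairs entail := pb1 _ _.

Definition pair_snd : functor entail_pairs entail := pb2 _ _.

End Entailment.

(* Main.v *)
(** The theory contains the tautological 2-cells dom ⇒ cod of the two
    projections 𝔼d.c𝔼 → 𝔼; since these agree on the middle proposition, the
    2-cells compose to a policy, which classifies a rule 𝔼d.c𝔼 → ℙ^2.  It lands
    in vertical arrows because [clf N] sends both factors to identities, so it
    factors through the pullback 𝔼 by a rule. *)
Require Import Defs.
From Stdlib Require Import FunctionalExtensionality ProofIrrelevance.
From mathcomp Require Import ssreflect ssrfun ssrbool.

Set Implicit Arguments.
Unset Strict Implicit.
Unset Printing Implicit Defensive.

(** * Extensionality for functors, transformations and packed arrows *)

Lemma functor_ext (C D : category) (F G : functor C D) :
  (forall a, F a = G a) ->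
  (forall a b (f : hom a b), Arr (fmap F f) = Arr (fmap G f)) -> F = G.
Proof.
case: F G => [F Fm Fi Fc] [G Gm Gi Gc] /= Eo Em.
have {}Eo : F = G by apply: functional_extensionality.
case: _ / Eo in Gm Gi Gc Em *.
have {}Em : Fm = Gm.
  apply: functional_extensionality_dep => a.
  apply: functional_extensionality_dep => b.
  apply: functional_extensionality_dep => f.
  exact: Arr_inj (Em a b f).
case: _ / Em in Gi Gc *.
by rewrite (proof_irrelevance _ Fi Gi) (proof_irrelevance _ Fc Gc).
Qed.

Lemma nat_trans_ext (C D : category) (F G : functor C D) (s t : nat_trans F G) :
  (forall a, s a = t a) -> s = t.
Proof.
case: s t => [s Hs] [t Ht] /= E.
have {}E : s = t by apply: functional_extensionality_dep.
by case: _ / E in Ht *; rewrite (proof_irrelevance _ Hs Ht).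
Qed.

(** Transporting the identity 2-cell, instead of casting each component, lets induction on [E] show
    that it is a policy. *)
Definition nat_of_eq (C D : category) (F G : functor C D) (E : F = G) :
  nat_trans F G := ecast G' (nat_trans F G') E (nat_id F).

Lemma nat_of_eqE (C D : category) (F G : functor C D) (E : F = G) a :
  Arr (nat_of_eq E a) = Arr (idm (F a)).
Proof. by case: _ / E. Qed.

Lemma Arr_comp_idm (C : category) (a b c x : C) (g : hom b c) (f : hom a b) :
  Arr g = Arr (idm x) -> Arr f = Arr (idm x) -> Arr (g ∘ f) = Arr (idm x).
Proof. by move=> Eg Ef; rewrite (Arr_comp Eg Ef) comp1m. Qed.

Lemma Arr_mor (C : category) (x : arr C) : Arr (mor x) = x.
Proof. by case: x. Qed.

Lemma Arr_fmap_eq (C D : category) (F G : functor C D) (a b : C) (f : hom a b) :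
  F = G -> Arr (fmap F f) = Arr (fmap G f).
Proof. by move->. Qed.

Lemma Arr_sq_hom (X : category) (v w v' w' : arr X) (m : sq_hom v w)
    (m' : sq_hom v' w') :
  v = v' -> w = w' -> Arr (proj1_sig m).1 = Arr (proj1_sig m').1 ->
  Arr (proj1_sig m).2 = Arr (proj1_sig m').2 ->
  Arr (C := arrow_cat X) m = Arr (C := arrow_cat X) m'.
Proof.
move=> Ev Ew; case: _ / Ev in m' *; case: _ / Ew in m' *.
case: m m' => [[m1 m2] Em] [[n1 n2] En] /= /Arr_inj E1 /Arr_inj E2.
by congr Arr; apply: sig_ext; rewrite /= E1 E2.
Qed.

(** * Universal properties of arrow categories and pullbacks *)

Section ArrowPairing.
Variables (Y X : category) (F G : functor Y X) (s : nat_trans F G).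

(** The functor that classifies [s] under the universal property of the arrow category. *)
Definition arrow_pair : functor Y (arrow_cat X).
Proof.
refine (@Functor Y (arrow_cat X) (fun a => Arr (s a))
  (fun a b f => exist _ (fmap F f, fmap G f) (ncomp_nat s f)) _ _).
- by move=> a; apply: sig_ext; rewrite /= !fmap_id.
- by move=> a b c g f; apply: sig_ext; rewrite /= !fmap_comp.
Defined.

Lemma fdom_arrow_pair : fdom X ⊙ arrow_pair = F.
Proof. exact: functor_ext. Qed.

Lemma fcod_arrow_pair : fcod X ⊙ arrow_pair = G.
Proof. exact: functor_ext. Qed.

End ArrowPairing.

Section PullbackPairing.
Variables (A B C Y : category) (f : functor A C) (g : functor B C).
Variables (h : functor Y A) (k : functor Y B) (E : f ⊙ h = g ⊙ k).

Definition pb_pair : functor Y (pullback f g).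
Proof.
refine (@Functor Y (pullback f g)
  (fun a => @PbOb _ _ _ f g (h a) (k a)
     (f_equal (fun F : functor Y C => F a) E))
  (fun a b m => @PbHom _ _ _ f g (PbOb _) (PbOb _) (fmap h m) (fmap k m)
     (Arr_fmap_eq m E)) _ _).
- by move=> a; apply: sig_ext; rewrite /= !fmap_id.
- by move=> a b c n m; apply: sig_ext; rewrite /= !fmap_comp.
Defined.

Lemma pb1_pair : pb1 f g ⊙ pb_pair = h.
Proof. exact: functor_ext. Qed.

Lemma pb2_pair : pb2 f g ⊙ pb_pair = k.
Proof. exact: functor_ext. Qed.

End PullbackPairing.

Lemma pb_square (A B C : category) (f : functor A C) (g : functor B C) :
  f ⊙ pb1 f g = g ⊙ pb2 f g.
Proof. by apply: functor_ext => [v|v w m]; [apply: pb_eq|apply: (proj2_sig m)]. Qed.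

Lemma fcompA (A B C D : category) (H : functor C D) (G : functor B C)
    (F : functor A B) : H ⊙ (G ⊙ F) = H ⊙ G ⊙ F.
Proof. exact: functor_ext. Qed.

(** * Derived closure properties of a judgemental theory *)

Section JudgementalClosure.
Variables (ctx : category) (T : pretheory).
Hypothesis HT : is_judgemental ctx T.

(** Projecting out of a pairing returns the original functors only up to propositional equality, so
    policies must be carried across such equalities. *)
Lemma policy_Arr (C D : category) (F G F' G' : functor C D)
    (s : nat_trans F G) (s' : nat_trans F' G') :
  F = F' -> G = G' -> (forall a, Arr (s a) = Arr (s' a)) ->
  policy T s -> policy T s'.
Proof.
move=> EF EG; case: _ / EF in s' *; case: _ / EG in s' * => E.
suff -> : s = s' by [].
by apply: nat_trans_ext => a; apply: Arr_inj.
Qed.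

Lemma policy_nat_of_eq (C D : category) (F G : functor C D) (E : F = G) :
  rule T F -> policy T (nat_of_eq E).
Proof. by case: _ / E => HF; apply: (jt_nat_id HT). Qed.

(** Whiskering the tautological 2-cell with the classifying functor gives back [s], so the cone
    clause for arrow categories applies. *)
Lemma rule_arrow_pair (Y X : category) (F G : functor Y X) (s : nat_trans F G) :
  policy T s -> rule T (arrow_pair s).
Proof.
move=> Hs; have HF := jt_policy_dom HT Hs.
apply: (jt_arrow_cone HT).
- exact: (jt_rule_cod HT HF).
- by rewrite fdom_arrow_pair.
- by rewrite fcod_arrow_pair; apply: (jt_policy_cod HT Hs).
- by apply: policy_Arr Hs => //; rewrite (fdom_arrow_pair, fcod_arrow_pair).
Qed.

(** This functor classifies the identity policy on [fid X]. *)
Lemma rule_id_arrow (X : category) : rule T (fid X) -> rule T (id_arrow X).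
Proof.
move=> HX; have -> : id_arrow X = arrow_pair (nat_id (fid X)).
  by apply: functor_ext => // a b f; apply: Arr_sq_hom.
exact/rule_arrow_pair/(jt_nat_id HT).
Qed.

(** This functor classifies the tautological policy of [X] whiskered with [F]. *)
Lemma rule_arrow_fun (X Y : category) (F : functor X Y) :
  rule T F -> rule T (arrow_fun F).
Proof.
move=> HF; have -> : arrow_fun F = arrow_pair (whisker_l F (tautological X)).
  by apply: functor_ext => // a b f; apply: Arr_sq_hom.
apply/rule_arrow_pair/(jt_whisker_l HT) => //.
exact/(jt_tautological HT)/(jt_rule_dom HT HF).
Qed.

Lemma rule_pb_pair (A B C Y : category) (f : functor A C) (g : functor B C)
    (h : functor Y A) (k : functor Y B) (E : f ⊙ h = g ⊙ k) :
  rule T f -> rule T g -> rule T h -> rule T k -> rule T (pb_pair E).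
Proof.
by move=> Hf Hg Hh Hk; apply: (jt_pb_cone HT); rewrite ?pb1_pair ?pb2_pair.
Qed.

End JudgementalClosure.

(** * Composition of entailments and its verticality *)

Section Transitivity.
Variable N : NDT.

(** Apply [fdom] to the pullback square defining the entailment classifier: the domain of an
    identity arrow is the context itself. *)
Lemma entail_dom_over : clf N ⊙ entail_dom N = entail_proj N.
Proof.
transitivity (fdom _ ⊙ (arrow_fun (clf N) ⊙ entail_arrow N)).
  exact: functor_ext.
by rewrite -pb_square; apply: functor_ext.
Qed.

Lemma entail_cod_over : clf N ⊙ entail_cod N = entail_proj N.
Proof.
transitivity (fcod _ ⊙ (arrow_fun (clf N) ⊙ entail_arrow N)).
  exact: functor_ext.
by rewrite -pb_square; apply: functor_ext.
Qed.

(** Objects of the arrow category of [FinSet] are packed arrows, so the object equation stored in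
    the pullback already says this. *)
Lemma entail_vertical (w : entail N) :
  Arr (fmap (clf N) (mor (entail_arrow N w))) = Arr (idm (entail_proj N w)).
Proof. exact: esym (pb_eq w). Qed.

Lemma pair_middle : entail_cod N ⊙ pair_fst N = entail_dom N ⊙ pair_snd N.
Proof. exact: pb_square. Qed.

(** Both members of a pair lie over the context of their shared middle proposition. *)
Lemma pair_proj : entail_proj N ⊙ pair_snd N = entail_proj N ⊙ pair_fst N.
Proof.
by rewrite -{1}entail_dom_over -fcompA -pair_middle fcompA entail_cod_over.
Qed.

(** The middle factor is an identity up to the equality of the two functors
    naming the middle proposition; strict pullbacks make that equality
    propositional only. *)
Definition cut : nat_trans (entail_dom N ⊙ pair_fst N)
                           (entail_cod N ⊙ pair_snd N) :=
  nat_comp (whisker_r (whisker_r (tautological _) (entail_arrow N)) (pair_snd N))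
    (nat_comp (nat_of_eq pair_middle)
       (whisker_r (whisker_r (tautological _) (entail_arrow N)) (pair_fst N))).

Lemma cutE (w : entail_pairs N) (psi phi chi : prp N)
    (f : hom psi phi) (g : hom phi chi) :
  entail_arrow N (pair_fst N w) = Arr f ->
  entail_arrow N (pair_snd N w) = Arr g -> Arr (cut w) = Arr (g ∘ f).
Proof.
(* Expanding [f] to [idm phi ∘ f] matches the three factors of [cut], which are then compared one by
   one. *)
move=> Ef Eg; rewrite -[f in RHS]comp1m.
have Em : Arr (nat_of_eq pair_middle w) = Arr (idm phi).
  by rewrite nat_of_eqE; apply: Arr_idm; exact: (f_equal (@tgt _) Ef).
rewrite -(Arr_mor (entail_arrow N _)) in Ef.
rewrite -(Arr_mor (entail_arrow N _)) in Eg.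
exact (Arr_comp Eg (Arr_comp Em Ef)).
Qed.

(** The cone condition for mapping into the entailment classifier. It holds because [clf N] sends
    each of the three factors of [cut] to the identity of the same context. *)
Lemma cut_vertical :
  id_arrow FinSet ⊙ (entail_proj N ⊙ pair_fst N)
  = arrow_fun (clf N) ⊙ arrow_pair cut.
Proof.
have Eob w : Arr (idm (entail_proj N (pair_fst N w)))
             = Arr (fmap (clf N) (cut w)).
  have E2 : Arr (fmap (clf N) (mor (entail_arrow N (pair_snd N w))))
            = Arr (idm (entail_proj N (pair_fst N w))).
    rewrite entail_vertical; apply: Arr_idm.
    exact: (f_equal (fun F : functor _ _ => F w) pair_proj).
  have Em : Arr (fmap (clf N) (nat_of_eq pair_middle w))
            = Arr (idm (entail_proj N (pair_fst N w))).
    rewrite (Arr_fmap _ (nat_of_eqE _ _)) fmap_id; apply: Arr_idm.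
    exact (f_equal (fun F : functor _ _ => F (pair_fst N w)) entail_cod_over).
  rewrite /cut [ncomp _ _]/= !fmap_comp; apply: esym.
  exact (Arr_comp_idm E2 (Arr_comp_idm Em (entail_vertical _))).
apply: functor_ext => [|v w m]; first exact: Eob.
apply: Arr_sq_hom; [exact: Eob|exact: Eob| |].
(* Each leg of the square is the action on arrows of a functor, so it is enough to equate the
   functors: both endpoints of the composite lie over the common context. *)
- apply: (@Arr_fmap_eq _ _ (entail_proj N ⊙ pair_fst N)
           (clf N ⊙ (entail_dom N ⊙ pair_fst N))).
  by rewrite fcompA entail_dom_over.
- apply: (@Arr_fmap_eq _ _ (entail_proj N ⊙ pair_fst N)
           (clf N ⊙ (entail_cod N ⊙ pair_snd N))).
  by rewrite fcompA entail_cod_over pair_proj.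
Qed.

(** * Membership of the constructions in any judgemental theory containing the classifier *)

Variables (ctx : category) (T : pretheory).
Hypotheses (HT : is_judgemental ctx T) (Hclf : rule T (clf N)).

Let Hid : rule T (id_arrow FinSet).
Proof. exact/(rule_id_arrow HT)/(jt_rule_cod HT Hclf). Qed.

Let Hfun : rule T (arrow_fun (clf N)).
Proof. exact: (rule_arrow_fun HT). Qed.

Let Hprp : rule T (fid (prp N)).
Proof. exact: (jt_rule_dom HT Hclf). Qed.

Lemma rule_entail_proj : rule T (entail_proj N).
Proof. exact: (jt_pb1 HT). Qed.

Lemma rule_entail_arrow : rule T (entail_arrow N).
Proof. exact: (jt_pb2 HT). Qed.

Lemma rule_entail_dom : rule T (entail_dom N).
Proof. exact: (jt_comp HT (jt_dom HT Hprp) rule_entail_arrow). Qed.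

Lemma rule_entail_cod : rule T (entail_cod N).
Proof. exact: (jt_comp HT (jt_cod HT Hprp) rule_entail_arrow). Qed.

Lemma rule_pair_fst : rule T (pair_fst N).
Proof. exact: (jt_pb1 HT rule_entail_cod rule_entail_dom). Qed.

Lemma rule_pair_snd : rule T (pair_snd N).
Proof. exact: (jt_pb2 HT rule_entail_cod rule_entail_dom). Qed.

Lemma policy_cut : policy T cut.
Proof.
have Htaut := jt_whisker_r HT (jt_tautological HT Hprp) rule_entail_arrow.
apply: (jt_nat_comp HT).
  exact: (jt_whisker_r HT Htaut rule_pair_snd).
apply: (jt_nat_comp HT); last exact: (jt_whisker_r HT Htaut rule_pair_fst).
apply: (policy_nat_of_eq HT).
exact: (jt_comp HT rule_entail_cod rule_pair_fst).
Qed.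

Lemma rule_cut : rule T (pb_pair cut_vertical).
Proof.
apply: (rule_pb_pair HT) => //; last exact/(rule_arrow_pair HT)/policy_cut.
exact: (jt_comp HT rule_entail_proj rule_pair_fst).
Qed.

End Transitivity.

Theorem lemma4p2p2 (N : NDT) :
  exists t : functor (entail_pairs N) (entail N),
    rule (ndt_theory N) t /\
    entail_proj N ⊙ t = entail_proj N ⊙ pair_fst N /\
    entail_dom N ⊙ t = entail_dom N ⊙ pair_fst N /\
    entail_cod N ⊙ t = entail_cod N ⊙ pair_snd N /\
    forall (w : entail_pairs N) (psi phi chi : prp N)
        (f : hom psi phi) (g : hom phi chi),
      entail_arrow N (pair_fst N w) = Arr f ->
      entail_arrow N (pair_snd N w) = Arr g ->
      entail_arrow N (t w) = Arr (g ∘ f).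
Proof.
exists (pb_pair (cut_vertical N)); split; [|split; [|split; [|split]]].
(* The generated theory is the intersection of all judgemental theories containing the generators,
   so an arbitrary such [T] is treated. *)
- move=> T HT HG; apply: (rule_cut HT).
  exact: (sub_rule HG (gen_clf N)).
- exact: pb1_pair.
- by rewrite /entail_dom -fcompA pb2_pair fdom_arrow_pair.
- by rewrite /entail_cod -fcompA pb2_pair fcod_arrow_pair.
(* The arrow underlying the value of the pairing at [w] computes to the component of [cut] at
   [w]. *)
- exact: cutE.
Qed.
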